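(* Let $Y_1,\dots,Y_n$ and $X_1,\dots,X_n$ be reflexive Banach spaces, and for each $i\in\{1,\dots,n\}$ let $T_i:X_i\to Y_i$ be a compact linear operator and let $A_i:Y_1\times\cdots\times Y_n\to\mathbb{R}$ be a continuous function which is locally Lipschitz in the $i$th variable and whose partial Clarke derivative $A_i^{\circ}:Y_1\times\cdots\times Y_n\times Y_i\to\mathbb{R}$ in the $i$th variable is upper semicontinuous. (i) Let $K_i\subset X_i$, $i\in\{1,\dots,n\}$, be nonempty, closed, convex and bounded sets. Then there exists $u^0=(u_1^0,\dots,u_n^0)\in K_1\times\cdots\times K_n$ such that for all $i\in\{1,\dots,n\}$ and all $(u_1,\dots,u_n)\in K_1\times\cdots\times K_n$, $$A_i^{\circ}\big((T_1u_1^0,\dots,T_nu_n^0);T_iu_i-T_iu_i^0\big)\ge 0,$$ i.e. $u^0$ is a Nash generalized derivative point for the functions $A_1,\dots,A_n$. (ii) Let $K_i\subset X_i$, $i\in\{1,\dots,n\}$, be nonempty sets that are only closed and convex, and suppose that there exist bounded, closed sets $K_i^0\subset K_i$ and points $v_i^0\in K_i^0$, $i\in\{1,\dots,n\}$, such that for every $u=(u_1,\dots,u_n)\in (K_1\times\cdots\times K_n)\setminus(K_1^0\times\cdots\times K_n^0)$, $$\sum_{i=1}^nA_i^{\circ}(Tu;T_iv_i^0-T_iu_i)<0 .$$ Then there exists $u^0=(u_1^0,\dots,u_n^0)\in K_1\times\cdots\times K_n$ such that for all $i\in\{1,\dots,n\}$ and all $u=(u_1,\dots,u_n)\in K_1\times\cdots\times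 K_n$, $$A_i^{\circ}(Tu^0;T_iu_i-T_iu_i^0)\ge 0,$$ i.e. $u^0$ is a Nash generalized derivative point for the functions $A_1,\dots,A_n$.
   Context: All Banach spaces are real. For $u=(u_1,\dots,u_n)$, write $Tu=(T_1u_1,\dots,T_nu_n)$. For a function $A_i:Y_1\times\cdots\times Y_n\to\mathbb{R}$ that is locally Lipschitz in the $i$th variable, its partial Clarke derivative in the $i$th variable at $(y_1,\dots,y_n)$ in the direction $h_i\in Y_i$ is $$A_i^{\circ}(y_1,\dots,y_n;h_i)=\limsup_{w\to y_i,\ \tau\searrow 0}\frac{A_i(y_1,\dots,w+\tau h_i,\dots,y_n)-A_i(y_1,\dots,w,\dots,y_n)}{\tau},$$ where $w\in Y_i$ and $w+\tau h_i$ stand in the $i$th place. In this statement, the phrase ''Nash generalized derivative point for $A_1,\dots,A_n$'' means precisely that the displayed inequalities $A_i^{\circ}(Tu^0;T_iu_i-T_iu_i^0)\ge0$ hold for all $i$ and all $(u_1,\dots,u_n)\in K_1\times\cdots\times K_n$. *)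

(* Defs.v *)
From HB Require Import structures.
From mathcomp Require Import all_boot all_order all_algebra.
From mathcomp Require Import all_classical all_reals all_analysis.

Set Implicit Arguments.
Unset Strict Implicit.
Unset Printing Implicit Defensive.

Import Order.TTheory GRing.Theory Num.Theory.
Import numFieldNormedType.Exports.

Local Open Scope classical_set_scope.
Local Open Scope ring_scope.

Section Reflexivity.
Context {R : realType}.
Implicit Type X : completeNormedModType R.

Definition dual_space X : set (X -> R^o) :=
  [set f | linear f /\ continuous f].

Definition dual_norm X (f : X -> R^o) : R :=
  sup [set `|f x| | x in [set x : X | `|x| <= 1]].

(* An element of the bidual is a functional on [dual_space X]; the values of
   [phi] outside [dual_space X] are irrelevant. *)
Definition in_bidual X (phi : (X -> R^o) -> R) : Prop :=
  (forall (a : R) (f g : X -> R^o), dual_space f -> dual_space g ->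
     phi (a *: f + g) = a * phi f + phi g) /\
  exists M : R, forall f : X -> R^o, dual_space f ->
    `|phi f| <= M * dual_norm f.

(* The canonical embedding of X into its bidual is onto. *)
Definition reflexive_space X : Prop :=
  forall phi : (X -> R^o) -> R, in_bidual phi ->
    exists x : X, forall f : X -> R^o, dual_space f -> phi f = f x.

End Reflexivity.

Definition compact_operator (R : realType) (X Y : completeNormedModType R)
    (T : {linear X -> Y}) : Prop :=
  forall B : set X, bounded_set B -> precompact (T @` B).

Definition locally_lipschitz (R : realType) (X : completeNormedModType R)
    (f : X -> R) : Prop :=
  forall x : X, exists2 U : set X,
    nbhs x U & [lipschitz (f w : R^o) | w in U].

(* Counterpart of the library's [lower_semicontinuous]. *)
Definition upper_semicontinuous (X : topologicalType) (R : numFieldType)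
    (f : X -> \bar R) : Prop :=
  forall (x : X) (a : R), (f x < a%:E)%E ->
    exists2 V, nbhs x V & forall y, V y -> (f y < a%:E)%E.

Section Clarke.
Context {R : realType} {n : nat}.
Implicit Type Y : 'I_n -> completeNormedModType R.

(* [dfwith y i w] is y with its i-th component replaced by w. *)
Definition locally_lipschitz_in Y (i : 'I_n) (A : prod_topology Y -> R) : Prop :=
  forall y : prod_topology Y,
    locally_lipschitz (fun w : Y i => A (dfwith y i w)).

(* The upper limit is taken in \bar R; it is finite as soon as A is locally
   Lipschitz in the i-th variable. *)
Definition partial_clarke Y (i : 'I_n) (A : prod_topology Y -> R)
    (y : prod_topology Y) (h : Y i) : \bar R :=
  limf_esup (fun p : Y i * R =>
      ((A (dfwith y i (p.1 + p.2 *: h)) - A (dfwith y i p.1)) / p.2)%:E)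
    (filter_prod (nbhs (y i)) (0%R^'+)).
Arguments partial_clarke {Y} i A y h.

(* Tu = (T_1 u_1, ..., T_n u_n) *)
Definition map_components (X Y : 'I_n -> completeNormedModType R)
    (T : forall i, {linear X i -> Y i}) (u : forall i, X i) : prod_topology Y :=
  fun i => T i (u i).

Definition nash_derivative_point (X Y : 'I_n -> completeNormedModType R)
    (T : forall i, {linear X i -> Y i}) (A : 'I_n -> prod_topology Y -> R)
    (K : forall i, set (X i)) (u0 : forall i, X i) : Prop :=
  forall (i : 'I_n) (u : forall j, X j), (forall j, K j (u j)) ->
    (0 <= partial_clarke i (A i) (map_components T u0)
            (T i (u i) - T i (u0 i))%R)%E.

End Clarke.

Arguments partial_clarke {R n Y} i A y h.

(* Main.v *)
Require Import Defs.
From HB Require Import structures.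
From mathcomp Require Import all_boot all_order all_algebra.
From mathcomp Require Import zify ring lra.

(** The statement is of the strength of the Brouwer fixed point theorem, already
    for one-dimensional spaces: the partial derivatives of the A i can be the
    components of any continuous vector field.  The proof has three independent
    ingredients.

    Reduction to compact sets.  The inequalities only involve the images
    T i (u i).  When K i is closed, convex and bounded in the reflexive space
    X i, the set T i @` K i is relatively compact because T i is compact, and it
    is closed because bounded closed convex sets of a reflexive space have the
    finite intersection property (reflexive_filter, by an ultrafilter limit in
    the bidual and by the separation of convex sets, obtained from the
    Hahn-Banach theorem in its sublinear form).  So T i @` K i is a norm compact
    convex set (compact_operator_image).

    Sublinearity.  For a locally Lipschitz function, the generalized directional
    derivative is finite and sublinear in the direction (clarke_sublinear).

    A Ky Fan argument.  On a product of compact convex sets, inequalities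
    given by functions that are sublinear in the direction and upper
    semicontinuous have a common solution (ky_fan).  Otherwise a finite open
    covering of a simplex would contradict simplex_common_point.  The latter is
    a continuous form of the Sperner lemma, which is proved without
    triangulations: the cells are the dominant sets of a family of linear
    orders on the grid points of the simplex, a combinatorial device due to
    Scarf, and a parity count yields a cell with all the colours
    (rainbow_dominant).

    This gives the bounded case (nash_bounded).  In the coercive case, one
    solves the problem on the intersection with a large ball; coercivity places
    the solution in the interior of the ball, where the ball is no
    constraint (nash_coercive). *)

Set Implicit Arguments.
Unset Strict Implicit.
Unset Printing Implicit Defensive.

(** * Dominant sets for a family of linear orders *)

Lemma even_sum (T : finType) (P : pred T) (F : T -> nat) :
  (forall x, P x -> ~~ odd (F x)) -> ~~ odd (\sum_(x | P x) F x).
Proof.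
move=> FP; apply: (big_ind (fun n => ~~ odd n)) => // m n.
by rewrite oddD => /negPf-> /negPf->.
Qed.

(** The points of V carry one linear order for each i : I, given by the rank
    r i.  The slack points s i stand for the facets of a simplex: s i is below
    everything in the order i, and above every ordinary point in the other
    orders.  A set may contain slack points exactly as a simplex of a
    triangulation may have a face on the boundary, so that no separate case
    for the boundary is needed. *)
Section DominantSets.
Variables (I V : finType) (r : I -> V -> nat) (s : I -> V) (c : V -> I).
Hypothesis r_inj : forall i, injective (r i).
Hypothesis slack_min : forall i v, r i (s i) <= r i v.
Hypothesis slack_big : forall i j v,
  j != i -> v \notin codom s -> r i v < r i (s j).
Hypothesis colour_slack : cancel s c.
Implicit Types (t : {set V}) (x y z : V) (d e i j : I).

(** Dominant sets with #|I| elements replace the full-dimensional simplices of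
    a triangulation, and their subsets with one element less the facets. *)
Definition dominant t :=
  [forall z, exists i, forall x in t, r i z <= r i x].

Definition completions t := [set y | (y \notin t) && dominant (y |: t)].

Lemma dominantP t :
  reflect (forall z, exists i, forall x, x \in t -> r i z <= r i x)
          (dominant t).
Proof.
apply: (iffP forallP) => H z; have := H z.
  by move=> /existsP[i /forall_inP]; exists i.
by case=> i Hi; apply/existsP; exists i; apply/forall_inP.
Qed.

Lemma dominant_sub t t' : t \subset t' -> dominant t' -> dominant t.
Proof.
move=> /subsetP tt' /dominantP dom; apply/dominantP => z.
by have [i iP] := dom z; exists i => x /tt'; apply: iP.
Qed.

(** A set with #|I| - 1 elements all of which are above s d in the order e
    contains slack points only, and not s e; this leaves the boundary set
    s @: [set~ e]. *)
Lemma slack_above t d e : #|t|.+1 = #|I| -> (t != s @: [set~ e]) -> e != d ->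
  exists2 x, x \in t & r e x < r e (s d).
Proof.
move=> cardt tN ed; apply/exists_inP; apply: contraR tN => /exists_inPn tP.
rewrite eqEcard (card_imset _ (can_inj colour_slack)) cardsC1 -cardt /= leqnn andbT.
apply/subsetP => x xt; have := tP x xt; rewrite -leqNgt => dx.
have /codomP[k xk] : x \in codom s.
  by apply: contraLR dx => xs; rewrite -ltnNge slack_big // eq_sym.
rewrite xk imset_f // !inE; apply: contraNneq ed => ke.
rewrite -(inj_eq (can_inj colour_slack)) -(inj_eq (@r_inj e)).
by rewrite eqn_leq slack_min; move: dx; rewrite xk ke.
Qed.

(** An interior facet lies in none or in two simplices.  Let a i be the
    minimum of t in the order i.  Dominance makes a onto t, so #|I| = #|t| + 1
    forces a i = a j for exactly one pair i, j.  A point y completing t must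
    take over the minimum in one order d, and a must stay onto, so d is i or j;
    dominance of the union then forces y to be the highest, in the order d, of
    the points above all the other minima. *)
Lemma completions_even t : #|t|.+1 = #|I| -> (forall e, t != s @: [set~ e]) ->
  ~~ odd #|completions t|.
Proof.
move=> cardt tN; have [->|[y0]] := set_0Vmem (completions t).
  by rewrite cards0.
rewrite inE => /andP[_ /(dominant_sub (subsetUr _ _)) domt].
have [t0|[x0 x0t]] := set_0Vmem t.
  move: cardt; rewrite t0 cards0 => /esym/eqP/fintype1P[e eP].
  have /eqP[] := tN e; apply/esym/setP => x; rewrite t0 inE; apply/imsetP.
  by case=> k; rewrite !inE (eP k) eqxx.
pose a i := [arg min_(x < x0 in t) r i x].
have a_in i : a i \in t by rewrite /a; case: arg_minnP.
have a_min i x : x \in t -> r i (a i) <= r i x.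
  by rewrite /a; case: arg_minnP => // y _ H /H.
have a_surj x : x \in t -> exists i, a i = x.
  move=> xt; have /dominantP/(_ x)[i iP] := domt; exists i.
  by apply: (@r_inj i); apply/eqP; rewrite eqn_leq a_min //= iP.
have [i [j [ij aij]]] : exists i j, i != j /\ a i = a j.
  have : ~~ injectiveb a.
    apply/injectiveP => /card_imset - /(_ predT) ca.
    have : #|a @: predT| <= #|t|.
      by apply/subset_leq_card/subsetP => _ /imsetP[k _ ->].
    by rewrite ca -cardt ltnn.
  by move=> /injectivePn[i [j ij aij]]; exists i, j; rewrite ij.
have a_injC d d' : d != d' -> a d = a d' -> {in [set~ d] &, injective a}.
  move=> dd' add'; apply/imset_injP; rewrite cardsC1 -cardt eqn_leq.
  rewrite (leq_trans (leq_imset_card _ _)) ?cardsC1 -?cardt //=.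
  apply/subset_leq_card/subsetP => x /a_surj[k <-].
  have [->|kd] := eqVneq k d; last by rewrite imset_f // !inE.
  by rewrite add' imset_f // !inE eq_sym.
pose M d := [set z | [forall e, (e != d) ==> (r e (a e) < r e z)]].
have MP d z : reflect (forall e, e != d -> r e (a e) < r e z) (z \in M d).
  by rewrite inE; apply: (iffP forall_inP).

(* The slack point s d shows that M d is not empty: this is where t is not a
   boundary set. *)
have s_in d : s d \in M d.
  apply/MP => e ed; have [x xt] := slack_above cardt (tN e) ed.
  by apply: leq_ltn_trans; apply: a_min.
pose m d := [arg max_(z > s d in M d) r d z].
have m_in d : m d \in M d by rewrite /m; case: arg_maxnP.
have m_max d z : z \in M d -> r d z <= r d (m d).
  by rewrite /m; case: arg_maxnP => // y _ H /H.
have m_out d d' : d != d' -> a d = a d' -> m d \notin t.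
  move=> dd' add'; apply/negP => /a_surj[e ame].
  have [ed|ed] := eqVneq e d; last first.
    by have /MP/(_ e ed) := m_in d; rewrite ame ltnn.
  have /MP/(_ d') := m_in d; rewrite eq_sym => /(_ dd').
  by rewrite -ame ed add' ltnn.
have m_compl d d' : d != d' -> a d = a d' -> m d \in completions t.
  move=> dd' add'; rewrite inE (m_out _ _ dd' add') /=.
  apply/dominantP => z; case/boolP: (z \in M d) => zM.
    exists d => x; rewrite !inE => /predU1P[->|xt]; first exact: m_max.
    have /dominantP/(_ (m d))[e eP] := domt.
    have [ed|ed] := eqVneq e d.
      by move: (eP x xt); rewrite ed; apply: leq_trans; apply: m_max.
    by have /MP/(_ e ed) := m_in d; rewrite ltnNge eP.
  move: zM; rewrite inE negb_forall => /existsP[e]; rewrite negb_imply -leqNgt.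
  move=> /andP[ed ze]; exists e => x; rewrite !inE => /predU1P[->|xt].
    by rewrite (leq_trans ze) // ltnW //; have /MP/(_ e ed) := m_in d.
  by rewrite (leq_trans ze) // a_min.
have complE y : y \in completions t -> y = m i \/ y = m j.
  rewrite inE => /andP[yt /dominantP domy].

  (* The order in which y becomes the minimum of the union. *)
  have [d dy] : exists d, forall x, x \in t -> r d y < r d x.
    have [d dy] := domy y; exists d => x xt; rewrite ltn_neqAle dy ?setU1r // andbT.
    by apply: contraNneq yt => /r_inj ->.
  have dP e : e != d -> r e (a e) < r e y.
    move=> ed.
    have [x xt xy] : exists2 x, x \in t & r e x <= r e y.
      apply/exists_inP; apply: contraT => /exists_inPn ey.

      (* The orders outside E are mapped onto t by a, which leaves room for
         one element of E only, while d and e would be two of them. *)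
      pose E := [set k | [forall (x | x \in t), r k y < r k x]].
      have EP k x : k \in E -> x \in t -> r k y < r k x.
        by rewrite inE => /forall_inP; apply.
      have tE : t \subset a @: ~: E.
        apply/subsetP => x xt; have [k kP] := domy x.
        have <- : a k = x.
          by apply: (@r_inj k); apply/eqP; rewrite eqn_leq a_min // kP ?setU1r.
        rewrite imset_f // inE; apply: contraL (kP y (setU11 _ _)) => kE.
        by rewrite -ltnNge EP.
      have : [set d; e] \subset E.
        apply/subsetP => k; rewrite !inE => /orP[] /eqP ->; apply/forall_inP.
          exact: dy.
        by move=> x /ey; rewrite -ltnNge.
      move=> /subset_leq_card; rewrite cards2 eq_sym ed.
      have := leq_trans (subset_leq_card tE) (leq_imset_card _ _).
      by have := cardsC E; lia.
    rewrite ltn_neqAle (leq_trans (a_min e x xt) xy) andbT.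
    by apply: contraNneq yt => /r_inj <-.
  have yM : y \in M d by apply/MP.
  have -> : y = m d.
    apply: (@r_inj d); apply/eqP; rewrite eqn_leq m_max //=.
    have [e eP] := domy (m d); have [ed|ed] := eqVneq e d.
      by move: (eP y (setU11 _ _)); rewrite ed.
    have /MP/(_ e ed) := m_in d; rewrite ltnNge eP //.
    by rewrite setU1r.
  have [<-|di] := eqVneq d i; first by left.
  have [<-|dj] := eqVneq d j; first by right.
  have a_injd : {in [set~ d] &, injective a}.
    apply/imset_injP; rewrite cardsC1 -cardt eqn_leq.
    rewrite (leq_trans (leq_imset_card _ _)) ?cardsC1 -?cardt //=.
    apply/subset_leq_card/subsetP => x xt; have [k kP] := domy x.
    have <- : a k = x.
      by apply: (@r_inj k); apply/eqP; rewrite eqn_leq a_min // kP ?setU1r.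
    rewrite imset_f // !inE; apply: contraTneq (kP y (setU11 _ _)) => ->.
    by rewrite -ltnNge dy.
  by case/eqP: ij; apply: a_injd; rewrite // !inE eq_sym.
have -> : completions t = [set m i; m j].
  apply/setP => y; rewrite !inE; apply/idP/idP => [yc|/orP[]/eqP->].
  - by have [|->|->] := complE y; rewrite ?inE ?eqxx ?orbT.
  - by have := m_compl _ _ ij aij; rewrite inE.
  - by have := m_compl j i; rewrite inE eq_sym; apply.
rewrite cards2; suff -> : m i != m j by [].
apply/eqP => mij; have /dominantP/(_ (m i))[e eP] := domt.
have [ei|ei] := eqVneq e i.
  have /MP/(_ i ij) := m_in j; rewrite -mij ltnNge.
  by move: (eP _ (a_in i)); rewrite ei => ->.
by have /MP/(_ e ei) := m_in i; rewrite ltnNge eP.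
Qed.

(** A boundary facet lies in one simplex: for k different from i its minimum in
    the order k is s k, which is below everything, so only the order i is left
    to bound the other points. *)
Lemma completions_boundary i : completions (s @: [set~ i]) =
  [set [arg max_(z > s i | z \notin s @: [set~ i]) r i z]].
Proof.
have si : s i \notin s @: [set~ i].
  apply/imsetP => -[k]; rewrite !inE => /eqP ki /(can_inj colour_slack).
  by move=> ik; apply: ki.
case: arg_maxnP => // y yN ymax'.
have ymax z : z \notin s @: [set~ i] -> r i z <= r i y by move/ymax'.
apply/setP => z; rewrite !inE; apply/andP/eqP => [[zN]|->].
  move=> /dominantP/(_ y)[e eP].
  have [ei|ei] := eqVneq e i.
    apply: (@r_inj i); apply/eqP; rewrite eqn_leq ymax //=.
    by move: (eP z (setU11 _ _)); rewrite ei.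
  case/negP: yN; have -> : y = s e.
    apply: (@r_inj e); apply/eqP; rewrite eqn_leq slack_min andbT eP //.
    by rewrite setU1r // imset_f // !inE.
  by rewrite imset_f // !inE.
split=> //; apply/dominantP => x.
case/boolP: (x \in s @: [set~ i]) => [/imsetP[k ki ->]|xN].
  by exists k => w _.
exists i => w; rewrite !inE => /predU1P[->|/imsetP[k]]; first exact: ymax.
rewrite !inE => ki ->; have [->|xi] := eqVneq x (s i); first exact: slack_min.
apply/ltnW/slack_big => //; apply: contraNN xN => /codomP[l xl].
rewrite xl imset_f // !inE; apply: contraNneq xi => <-.
by rewrite xl.
Qed.

(** If removing x leaves each colour but i exactly once, and x does not have the
    colour i, then x shares its colour with a single other point, and the only
    other choice is to remove that point instead. *)
Lemma facets_even i t : #|t| = #|I| -> c @: t != setT ->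
  ~~ odd #|[set x in t | c @: (t :\ x) == [set~ i]]|.
Proof.
move=> cardt ct; set F := [set x in t | _].
have [->|[x]] := set_0Vmem F; first by rewrite cards0.
rewrite inE => /andP[xt /eqP cx].
have cxi : c x != i.
  apply: contraNneq ct => cxi.
  by rewrite -(setD1K xt) imsetU1 cx cxi setUCr.
have /imsetP[y] : c x \in c @: (t :\ x) by rewrite cx !inE.
rewrite !inE => /andP[yx yt] cxy.
have c_inj : {in t :\ x &, injective c}.
  by apply/imset_injP; rewrite cx cardsC1 -cardt (cardsD1 x t) xt.
have -> : F = [set x; y].
  apply/setP => z; rewrite !inE; apply/andP/orP => [[zt /eqP cz]|[]/eqP->].
  - have [->|zx] := eqVneq z x; first by left.
    right; apply/eqP/c_inj; rewrite ?inE ?zx ?yx //.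
    have : c z \in c @: (t :\ z).
      by rewrite cz -cx imset_f // !inE zx.
    move=> /imsetP[w]; rewrite !inE => /andP[wz wt] czw.
    have [wx|wx] := eqVneq w x; first by rewrite czw wx.
    by case/eqP: wz; apply: c_inj; rewrite ?inE ?wx ?zx.
  - by rewrite xt cx.
  - rewrite yt; split=> //; apply/eqP; rewrite -cx.
    apply/setP => k; apply/imsetP/imsetP => -[w]; rewrite !inE.
      move=> /andP[wy wt] ->; have [->|wx] := eqVneq w x.
        by exists y; rewrite // !inE yx.
      by exists w; rewrite // !inE wx.
    move=> /andP[wx wt] ->; have [->|wy] := eqVneq w y.
      by exists x; rewrite // !inE eq_sym yx.
    by exists w; rewrite // !inE wy.
by rewrite cards2 eq_sym yx.
Qed.

(** The double counting of Sperner: count the pairs of a facet carrying all the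
    colours but i and of a simplex containing it.  Seen from the facets their
    number is odd, because the boundary facet s @: [set~ i] is the only one that
    lies in an odd number of simplices.  Seen from the simplices it would be
    even if none of them carried all the colours. *)
Theorem rainbow_dominant (i : I) :
  exists t, [/\ dominant t, #|t| = #|I| & c @: t = setT].
Proof.
suff /exists_inP[t tP /eqP ct] :
    [exists (t | dominant t && (#|t| == #|I|)), c @: t == setT].
  by exists t; case/andP: tP => domt /eqP.
apply: contraT => /exists_inPn norainbow.
pose door t := (#|t|.+1 == #|I|) && (c @: t == [set~ i]).
have count : \sum_(t | door t) #|completions t| =
    \sum_(t | dominant t && (#|t| == #|I|))
      #|[set x in t | c @: (t :\ x) == [set~ i]]|.
  under eq_bigr do rewrite -sum1dep_card.
  under [RHS]eq_bigr do rewrite -sum1dep_card.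
  rewrite (exchange_big_dep predT) //= [RHS](exchange_big_dep predT) //=.
  apply: eq_bigr => x _.
  rewrite (reindex_onto (fun t => t :\ x) (fun t => x |: t)) /=; last first.
    by move=> t /and3P[_ xt _]; rewrite setU1K.
  apply: eq_bigl => t; have [xt|xt] := boolP (x \in t); last first.
    rewrite !andbF; apply/negP => /andP[_ /eqP tx]; case/negP: xt.
    by rewrite -tx setU11.
  rewrite setD1K // eqxx setD11 !andbT /= /door (cardsD1 x t) xt add1n.
  by rewrite andbC andbA.
pose b := s @: [set~ i].
have db : door b.
  rewrite /door card_imset; last exact: can_inj colour_slack.
  rewrite cardsC1 prednK ?eqxx /=; last by apply/card_gt0P; exists i.
  by rewrite -imset_comp (eq_imset _ (colour_slack : _ =1 id)) imset_id.
have : odd (\sum_(t | door t) #|completions t|).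
  rewrite (bigD1 b) //= completions_boundary cards1 oddD /=.
  apply: even_sum => t /andP[/andP[/eqP cardt /eqP ct] tb].
  apply: completions_even => // e; apply: contraNneq tb => te.
  have : e \notin c @: t.
    rewrite te -imset_comp (eq_imset _ (colour_slack : _ =1 id)) imset_id.
    by rewrite !inE eqxx.
  by rewrite ct !inE negbK te => /eqP->.
rewrite count => /negPn; case/negP; apply: even_sum => t tP.
by apply: facets_even; [case/andP: tP => _ /eqP | exact: norainbow].
Qed.

End DominantSets.

(** * The Sperner lemma on the grid points of a simplex *)

Section Grid.
Variables (I : finType) (N : nat).

Definition grid := {x : {ffun I -> 'I_N.+1} | \sum_i x i == N}.

Definition coords (x : grid) : {ffun I -> nat} := [ffun i => val (val x i)].

Lemma sum_coords x : \sum_i coords x i = N.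
Proof.
by rewrite -[RHS](eqP (valP x)); apply: eq_bigr => i _; rewrite ffunE.
Qed.

Lemma grid_coords (q : {ffun I -> nat}) : \sum_i q i = N ->
  exists x, coords x = q.
Proof.
move=> qN; have qle i : q i < N.+1.
  by rewrite ltnS -qN (bigD1 i) //= leq_addr.
have qP : \sum_i ([ffun i => Ordinal (qle i)] : {ffun I -> 'I_N.+1}) i == N.
  by rewrite -[X in _ == X]qN; apply/eqP/eq_bigr => i _; rewrite ffunE.
exists (exist (fun x : {ffun I -> 'I_N.+1} => is_true (\sum_i x i == N)) _ qP).
by apply/ffunP => i; rewrite !ffunE.
Qed.

(** The order i is the lexicographic order on the i-th coordinate and the
    enumeration rank, which breaks the ties.  The slack points take the rank 0
    in their own order and ranks beyond all grid points in the others. *)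
Definition point_rank (i : I) (v : I + grid) : nat :=
  match v with
  | inl j => if j == i then 0 else (N.+1 * #|{: grid}| + enum_rank j).+1
  | inr x => (coords x i * #|{: grid}| + enum_rank x).+1
  end.

Lemma point_rank_lt i (x : grid) :
  coords x i * #|{: grid}| + enum_rank x < N.+1 * #|{: grid}|.
Proof.
have xN : coords x i <= N by rewrite ffunE; exact: leq_ord.
apply: (@leq_trans ((coords x i).+1 * #|{: grid}|)).
  by rewrite mulSnr -addnS leq_add2l ltn_ord.
by rewrite leq_mul2r ltnS xN orbT.
Qed.

Lemma point_rank_inj i : injective (point_rank i).
Proof.
move=> [j|x] [k|y] //=.
- case: eqVneq => [->|ji]; case: eqVneq => [->|ki] // [] /addnI.
  by move/val_inj/enum_rank_inj->.
- case: eqVneq => // _ [E]; have := point_rank_lt i y.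
  by rewrite -E ltnNge leq_addr.
- case: eqVneq => // _ [E]; have := point_rank_lt i x.
  by rewrite E ltnNge leq_addr.
- move=> [] /(congr1 (modn^~ #|{: grid}|)); rewrite !modnMDl !modn_small //.
  by move/val_inj/enum_rank_inj->.
Qed.

Lemma point_rank_coords i (x y : grid) :
  point_rank i (inr x) <= point_rank i (inr y) -> coords x i <= coords y i.
Proof.
rewrite /= ltnS => xy; rewrite -ltnS -(@ltn_pmul2r #|{: grid}|); last first.
  by apply/card_gt0P; exists x.
rewrite (leq_ltn_trans (leq_trans (leq_addr _ _) xy)) //.
by rewrite mulSnr -addnS leq_add2l ltn_ord.
Qed.

(** This is the form of the Sperner lemma used below: q / N is a point of the
    simplex, and each vertex k of the smallest face containing it is the colour
    of a grid point at distance at most #|I| / N.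

    It is read off a dominant set t carrying all the colours.  Let C be the set
    of the colours not taken by slack points of t, and m i, for i in C, the
    least i-th coordinate of the grid points of t.  Dominance says that no grid
    point exceeds m in all the coordinates of C; hence the sum of m is more
    than N - #|I|, since otherwise adding 1 to each m i would leave enough mass
    for such a grid point.  The grid points of t are above m, so they are close
    to it, and q is m with the missing mass added to a coordinate in C. *)
Theorem grid_rainbow (i0 : I) (c : {ffun I -> nat} -> I) :
  exists2 q : {ffun I -> nat}, \sum_i q i = N &
    forall k, 0 < q k -> exists x : {ffun I -> nat},
      [/\ \sum_i x i = N, c x = k &
          forall i, (x i <= q i + #|I|) && (q i <= x i + #|I|)].
Proof.
pose c' (v : I + grid) := match v with inl i => i | inr x => c (coords x) end.
have [|i j v ji vs||t [/dominantP domt cardt ct]] :=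
  @rainbow_dominant I _ point_rank inl c' point_rank_inj _ _ _ i0.
- by move=> i v /=; rewrite eqxx.
- case: v vs => [k|x _] /=; first by rewrite codom_f.
  by rewrite (negPf ji) ltnS (leq_trans (point_rank_lt i x)) // leq_addr.
- by [].
pose C := [set k | inl k \notin t].
have domC z : exists2 i, i \in C & forall x, inr x \in t -> coords z i <= coords x i.
  have [i iP] := domt (inr z); exists i.
    by rewrite inE; apply/negP => /iP /=; rewrite eqxx.
  by move=> x /iP; apply: point_rank_coords.
have colC k : k \in C -> exists2 x, inr x \in t & c (coords x) = k.
  rewrite inE => kt; have : k \in c' @: t by rewrite ct inE.
  move=> /imsetP[[j|x] vt kv]; first by rewrite kv vt in kt.
  by exists x.

have unitP (d : {ffun I -> nat}) k n : k \in C ->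
    \sum_i ([ffun i => d i + if i == k then n else 0] : {ffun I -> nat}) i =
    \sum_i d i + n.
  move=> kC; under eq_bigr do rewrite ffunE.
  by rewrite big_split /= -big_mkcond big_pred1_eq.
have [z0 _] : exists x, coords x = [ffun i => if i == i0 then N else 0].
  apply: grid_coords; under eq_bigr do rewrite ffunE.
  by rewrite -big_mkcond big_pred1_eq.
have [k0 k0C _] := domC z0; have [x0 x0t _] := colC _ k0C.
pose m : {ffun I -> nat} := [ffun i => if i \in C then
  coords [arg min_(x < x0 | inr x \in t) coords x i] i else 0].
have mC i : i \notin C -> m i = 0 by rewrite ffunE => /negPf->.
have m_min x i : inr x \in t -> m i <= coords x i.
  by move=> xt; rewrite ffunE; case: ifP => //; case: arg_minnP => // y _ /(_ x xt).
have sm x : inr x \in t -> forall i, coords x i + \sum_i m i <= m i + N.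
  move=> xt i; rewrite -(sum_coords x) (bigD1 i) //= [X in _ <= _ + X](bigD1 i) //=.
  have : \sum_(j | j != i) m j <= \sum_(j | j != i) coords x j.
    by apply: leq_sum => j _; exact: m_min.
  by lia.
have smN : \sum_i m i <= N.
  by have := sm _ x0t k0; have := m_min _ k0 x0t; lia.
have Nsm : N < \sum_i m i + #|I|.
  rewrite ltnNge; apply/negP => smI.
  pose m1 : {ffun I -> nat} := [ffun i => m i + (i \in C)].
  have sm1 : \sum_i m1 i <= N.
    apply: leq_trans smI; under eq_bigr do rewrite ffunE.
    rewrite big_split leq_add2l /= -sum1_card.
    by apply: leq_sum => i _; case: (_ \in _).
  have [] := @grid_coords [ffun i => m1 i + if i == k0 then N - \sum_i m1 i else 0].
    by rewrite unitP // subnKC.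
  move=> z zE; have [i iC iP] := domC z.
  have : m i < coords z i.
    by rewrite zE [X in _ < X]ffunE [m1 i]ffunE iC addn1 leq_addr.
  rewrite ffunE iC; case: arg_minnP => // y yt _.
  by rewrite ltnNge iP.
exists [ffun i => m i + if i == k0 then N - \sum_i m i else 0].
  by rewrite unitP // subnKC.
move=> k; rewrite ffunE => qk.
have kC : k \in C.
  apply: contraLR qk => kC; rewrite mC //; case: eqVneq => // kk0.
  by rewrite kk0 k0C in kC.
have [x xt cx] := colC k kC; exists (coords x); split=> //; first exact: sum_coords.
move=> i; rewrite ffunE; have := sm x xt i; have := m_min x i xt.
by case: ifP => _; lia.
Qed.
End Grid.

From mathcomp Require Import all_classical all_reals all_analysis.

Import Order.TTheory GRing.Theory Num.Theory.
Import numFieldNormedType.Exports.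

Local Open Scope classical_set_scope.
Local Open Scope ring_scope.

(** * Open coverings of the simplex *)

Lemma continuous_sum (K : numFieldType) (E : pseudoMetricNormedZmodType K)
    (S : topologicalType) (I : finType) (F : I -> S -> E) :
  (forall i, continuous (F i)) -> continuous (fun x => \sum_i F i x).
Proof.
move=> cF; apply: continuous_big => [|i _]; last exact: cF.
exact: (@pseudometric_normed_Zmodule.add_continuous _ E).
Qed.

Definition simplex (R : realType) m : set 'rV[R]_m :=
  [set x | (forall i, 0 <= x ord0 i) /\ \sum_i x ord0 i = 1].

Lemma simplex_compact (R : realType) m : compact (@simplex R m).
Proof.
have cB := @rV_compact R m (fun=> `[0, 1]%classic)
  (fun=> segment_compact (a := 0 : R) (b := 1)).
apply: subclosed_compact cB _; last first.
  move=> x [x0 x1] i /=; rewrite in_itv /= x0 -x1 (bigD1 i) //= lerDl.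
  exact: sumr_ge0.
have -> : @simplex R m =
    \bigcap_i ((fun x : 'rV[R]_m => x ord0 i) @^-1` [set r | 0 <= r]) `&`
    (fun x : 'rV[R]_m => \sum_i x ord0 i) @^-1` [set r | r = 1].
  by apply/seteqP; split => x [H1 H2]; split => // i; [move=> _|]; exact: H1.
apply: closedI.
  apply: closed_bigI => i _; apply: (preimage_closed _ (@closed_ge _ 0)) => x _.
  exact: coord_continuous.
apply: (preimage_closed _ (@closed_eq _ 1)) => x _.
by apply: continuous_sum => i; exact: coord_continuous.
Qed.

(** An equivalent form of the Brouwer fixed point theorem.  Choose a Lebesgue
    number e of the covering, colour each point x of a grid of mesh below e / m
    by some k such that the ball of radius e around x is inside U k, and apply
    the Sperner lemma. *)
Theorem simplex_common_point (R : realType) m (U : 'I_m -> set 'rV[R]_m) :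
  (0 < m)%N -> (forall x, simplex x -> exists k, nbhs x (U k)) ->
  exists2 x, simplex x & forall k, 0 < x ord0 k -> U k x.
Proof.
move=> m0 covU.
have /compact_near_coveringP cpt := @simplex_compact R m.
have [e [e0 eU]] : exists e : R, 0 < e /\
    forall x, simplex x -> exists k, ball x e `<=` U k.
  have := cpt R 0^'+ (fun e x => exists k, ball x e `<=` U k) _ _.
  case.
    move=> x /covU[k] /nbhs_ballP[e /= e0 eU].
    exists (ball x (e / 2), [set e' | e' < e / 2]); first split => //=.
    - by apply: nbhsx_ballx; rewrite divr_gt0.
    - by apply: nbhs_right_lt; rewrite divr_gt0.
    - move=> [x' e'] /= [xx' e'e]; exists k; apply: (subset_trans _ eU) => y x'y.
      rewrite [e]splitr; apply: ball_triangle xx' _.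
      by apply: le_ball x'y; apply: ltW.
  move=> e /= e0 eU; exists (e / 2); rewrite divr_gt0 //; split=> // x xs.
  apply: eU xs => //=; last by rewrite divr_gt0.
  by rewrite sub0r normrN gtr0_norm ?divr_gt0 // ltr_pdivrMr // ltr_pMr // ltr1n.
pose i0 : 'I_m := Ordinal m0.
pose N := (Num.truncn (m%:R / e)).+1.
have N0 : 0 < N%:R :> R by rewrite ltr0n.
have Nm : m%:R / N%:R < e.
  by rewrite ltr_pdivrMr // mulrC -ltr_pdivrMr // truncnS_gt.
pose pt (q : {ffun 'I_m -> nat}) : 'rV[R]_m := \row_i ((q i)%:R / N%:R).
have pt_simplex (q : {ffun _}) : (\sum_i q i)%N = N -> simplex (pt q).
  move=> qN; split=> [i|]; first by rewrite mxE divr_ge0.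
  under eq_bigr do rewrite mxE.
  by rewrite -mulr_suml -natr_sum qN divff // gt_eqF.
have [q qN qP] := @grid_rainbow 'I_m N i0
  (fun q => xget i0 [set k | ball (pt q) e `<=` U k]).
exists (pt q); first exact: pt_simplex.
move=> k; rewrite mxE pmulr_lgt0 ?invr_gt0 // ltr0n => /qP[x [xN xk xq]].
have : ball (pt x) e `<=` U k.
  by have := xgetPex i0 (eU _ (pt_simplex _ xN)); rewrite xk.
apply; split => // i j; rewrite !mxE /ball /= -mulrBl normrM.
rewrite (@gtr0_norm _ N%:R^-1) ?invr_gt0 //; apply: le_lt_trans Nm.
rewrite ler_pM2r ?invr_gt0 // ler_norml.
have := xq j; rewrite card_ord -!(ler_nat R) !natrD; lra.
Unshelve. all: by end_near. Qed.

(** * Sublinear inequalities on products of compact convex sets *)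

Lemma convex_setP (R : realType) (E : lmodType R) (A : set E) :
  convex_set A <-> forall x y (a : R), A x -> A y -> 0 <= a <= 1 ->
    A (a *: x + (1 - a) *: y).
Proof.
split=> [cA x y a Ax Ay /andP[a0 a1]|cA x y l].
  by have := cA x y (Itv01 a0 a1); rewrite !inE; apply.
by rewrite !inE => Ax Ay; apply: cA => //; apply/andP; split.
Qed.

(** The induction is on a list of indices and concerns normalized sums over
    that list, because its partial sums of weights are not 1. *)
Lemma convex_sum (R : realType) (E : lmodType R) (A : set E) (I : finType)
    (w : I -> R) (v : I -> E) :
  convex_set A -> (forall k, 0 <= w k) -> \sum_k w k = 1 ->
  (forall k, A (v k)) -> A (\sum_k w k *: v k).
Proof.
move=> /convex_setP cA w0 w1 Av.
suff H (s : seq I) : 0 < \sum_(k <- s) w k ->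
    A ((\sum_(k <- s) w k)^-1 *: \sum_(k <- s) w k *: v k).
  by have := H (index_enum I); rewrite w1 invr1 scale1r; apply.
elim: s => [|k s IH]; first by rewrite big_nil ltxx.
rewrite !big_cons; set W := \sum_(j <- s) w j in IH *.
have W0 : 0 <= W by apply: sumr_ge0.
rewrite le_eqVlt in W0; case/predU1P: W0 => [W0|W0] wkW.
  move: (W0) => /esym/eqP; rewrite psumr_eq0 // => /allP ws.
  have -> : \sum_(j <- s) w j *: v j = 0.
    by apply: big1_seq => j /= js; rewrite (eqP (ws j js)) scale0r.
  by rewrite addr0 -W0 addr0 scalerA mulVf ?scale1r // gt_eqF //; lra.
rewrite scalerDr scalerA.
set a := _^-1 * w k.
have -> : (w k + W)^-1 *: \sum_(j <- s) w j *: v j =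
    (1 - a) *: (W^-1 *: \sum_(j <- s) w j *: v j).
  rewrite scalerA; congr (_ *: _); rewrite /a; field.
  by rewrite !gt_eqF.
apply: cA (Av k) (IH W0) _; apply/andP; split.
  by rewrite mulr_ge0 ?invr_ge0 // ltW.
by rewrite /a mulrC ler_pdivrMr // mul1r lerDl ltW.
Qed.

Definition sublinear (R : realType) (E : lmodType R) (p : E -> R) :=
  (forall x y, p (x + y) <= p x + p y) /\
  (forall (a : R) x, 0 <= a -> p (a *: x) = a * p x).

Lemma sublinear0 (R : realType) (E : lmodType R) (p : E -> R) :
  sublinear p -> p 0 = 0.
Proof. by case=> _ pZ; rewrite -(scale0r 0) pZ // mul0r. Qed.

Lemma sublinear_sum (R : realType) (E : lmodType R) (p : E -> R) (I : finType)
    (w : I -> R) (v : I -> E) :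
  sublinear p -> (forall k, 0 <= w k) ->
  p (\sum_k w k *: v k) <= \sum_k w k * p (v k).
Proof.
move=> ps w0; elim/big_ind2 : _ => [|x a y b xa yb|k _].
- by rewrite sublinear0.
- by apply: le_trans (lerD xa yb); case: ps.
- by case: ps => _ ->.
Qed.

(** A near-covering along the filter of the large finite lists of indices. *)
Lemma compact_finite_subcover (S : topologicalType) (Z : Type) (K : set S)
    (V : Z -> set S) :
  compact K -> (forall x, K x -> exists z, nbhs x (V z)) ->
  exists m (z : 'I_m -> Z), forall x, K x -> exists k, V (z k) x.
Proof.
move=> /compact_near_coveringP cptK covV.
pose F : set_system (seq {classic Z}) :=
  filter_from setT (fun s : seq {classic Z} =>
    [set s' : seq {classic Z} | {subset s <= s'}]).
have FF : Filter F.
  apply: filter_fromT_filter; first by exists [::].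
  move=> s s'; exists (s ++ s') => s'' /= ss.
  by split=> z zs; apply: ss; rewrite mem_cat zs ?orbT.
have [x /covV[z zx]|s _ sP] := cptK _ F
    (fun (s : seq {classic Z}) x => exists2 z, z \in s & V z x) FF.
  exists (V z, [set s : seq {classic Z} | {subset [:: (z : {classic Z})] <= s}]) => /=.
    by split=> //; exists [:: (z : {classic Z})].
  by move=> [y s] /= [Vzy zs]; exists z => //; apply: zs; rewrite inE.
exists (size s), (tnth (in_tuple s)) => x Kx.
have [z zs Vx] := sP s (fun z => id) x Kx.
have /tnthP[k zk] : z \in in_tuple s by [].
by exists k; rewrite -zk.
Qed.

Lemma continuous_prod (S : topologicalType) (I : Type)
    (Y : I -> topologicalType) (g : S -> prod_topology Y) :
  (forall i, continuous (fun x => g x i)) -> continuous g.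
Proof.
move=> cg x; apply/cvg_sup => i U [?/= [[W oW <-]]] /= Wf /filterS; apply.
by apply: (cg i); exact: open_nbhs_nbhs.
Qed.

(** If no y0 existed, each y would have a z with F y z < 0, where F y z is the
    sum of the f i y (z i - y i): a z violating one inequality is completed by
    the components of y.  By upper semicontinuity and compactness finitely many
    z k suffice, and their barycentric combinations g x, for x in a simplex,
    satisfy F (g x) (z k) < 0 for some k depending on x.  By
    simplex_common_point, at some x this holds for all k in the support of x;
    but F (g x) is convex and vanishes at g x, which is the combination of
    these z k. *)
Theorem ky_fan (R : realType) n (Y : 'I_n -> completeNormedModType R)
    (C : forall i, set (Y i)) (f : forall i, prod_topology Y -> Y i -> R) :
  (forall i, compact (C i)) -> (forall i, convex_set (C i)) ->
  (forall i, C i !=set0) -> (forall i y, sublinear (f i y)) ->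
  (forall i (z : Y i) y a, f i y (z - y i) < a ->
     nbhs y [set y' | f i y' (z - y' i) < a]) ->
  exists2 y0 : prod_topology Y, (forall i, C i (y0 i)) &
    forall i z, C i z -> 0 <= f i y0 (z - y0 i).
Proof.
move=> cptC convC C0 f_sub f_usc.
pose K : set (prod_topology Y) := [set y | forall i, C i (y i)].
have cptK : compact K by apply: tychonoff.
pose F y (z : prod_topology Y) := \sum_i f i y (z i - y i).
suff [y0 Ky0 Fy0] : exists2 y0, K y0 & forall z, K z -> 0 <= F y0 z.
  exists y0 => // i z Cz.
  have Kd : K (dfwith y0 i z).
    move=> j; have [->|ji] := eqVneq j i; first by rewrite dfwithin.
    by rewrite dfwithout // eq_sym.
  have := Fy0 _ Kd; rewrite /F (bigD1 i) //= dfwithin big1 ?addr0 //.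
  by move=> j ji; rewrite dfwithout 1?eq_sym // subrr sublinear0.
have F_usc z y : F y z < 0 -> nbhs y [set y' | F y' z < 0].
  move=> Fyz; pose e := - F y z / n.+1%:R.
  have e0 : 0 < e by rewrite divr_gt0 // oppr_gt0.
  have : \forall y' \near y, forall i, f i y' (z i - y' i) < f i y (z i - y i) + e.
    pose P i : set (prod_topology Y) :=
      [set y' | f i y' (z i - y' i) < f i y (z i - y i) + e].
    apply: (@filter_forall _ _ P (nbhs y)) => i.
    apply: (f_usc i (z i) y (f i y (z i - y i) + e)).
    by rewrite ltrDl.
  apply: filterS => y' fy' /=.
  apply: (@le_lt_trans _ _ (\sum_i (f i y (z i - y i) + e))).
    by apply: ler_sum => i _; apply: ltW.
  rewrite big_split /= sumr_const card_ord -/(F y z).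
  have -> : F y z = - (e *+ n.+1) by rewrite /e -mulr_natr divfK ?opprK.
  by rewrite mulrS opprD addrNK oppr_lt0.
apply: contrapT => noy0.
have noy y : K y -> exists z : {z | K z}, nbhs y [set y' | F y' (projT1 z) < 0].
  move=> Ky; have /existsNP[z /not_implyP[Kz /negP]] : ~ forall z, K z -> 0 <= F y z.
    by move=> Fy; apply: noy0; exists y.
  by rewrite -ltNge => /F_usc Fz; exists (exist _ z Kz).
have [m [z zP]] := compact_finite_subcover cptK noy.
have m0 : (0 < m)%N.
  have [k _] := zP (fun i => projT1 (cid (C0 i))) (fun i => projT2 (cid (C0 i))).
  exact: leq_ltn_trans (ltn_ord k).
pose g (x : 'rV[R]_m) : prod_topology Y :=
  fun i => \sum_k x ord0 k *: projT1 (z k) i.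
have gc : continuous g.
  apply: continuous_prod => i; apply: continuous_sum => k x.
  have xk : (fun u : 'rV[R]_m => u ord0 k) @ x --> x ord0 k.
    exact: coord_continuous.
  exact: (@cvgZr_tmp _ _ _ _ (nbhs_filter x) _ _ _ xk).
have Kg x : simplex x -> K (g x).
  move=> [x0 x1] i; apply: convex_sum => // k.
  exact: (projT2 (z k)).
have [|x [x0 x1] xP] := @simplex_common_point R m
  (fun k => g @^-1` [set y | F y (projT1 (z k)) < 0]) m0.
  move=> x sx; have [k kP] := zP _ (Kg x sx); exists k.
  by apply: gc; apply: F_usc.
have : 0 <= \sum_k x ord0 k * F (g x) (projT1 (z k)).
  apply: (@le_trans _ _ (\sum_i f i (g x) 0)).
    by rewrite big1 // => i _; rewrite sublinear0.
  under [leRHS]eq_bigr do rewrite /F mulr_sumr.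
  rewrite [leRHS]exchange_big /=; apply: ler_sum => i _.
  have <- : \sum_k x ord0 k *: (projT1 (z k) i - g x i) = 0.
    under eq_bigr do rewrite scalerBr.
    by rewrite sumrB -scaler_suml x1 scale1r subrr.
  exact: sublinear_sum.
apply/negP; rewrite -ltNge.
have [k xk] : exists k, 0 < x ord0 k.
  apply: contrapT => /forallNP xN; have := oner_neq0 R; rewrite -x1 big1 ?eqxx //.
  by move=> k _; apply/eqP; rewrite eq_le x0 leNgt andbT; apply/negP/xN.
rewrite (bigD1 k) //= -[ltRHS]addr0 ltr_leD ?pmulr_rlt0 ?xP //.
apply: sumr_le0 => j _; have := x0 j; rewrite le_eqVlt => /predU1P[<-|xj].
  by rewrite mul0r.
by rewrite pmulr_rle0 // ltW // xP.
Qed.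

(** * The Hahn-Banach theorem *)

Section HahnBanach.
Variables (R : realType) (E : lmodType R).
Implicit Types (p q : E -> R) (x y z c : E) (D : set E).

Lemma sublinearN p x : sublinear p -> - p (- x) <= p x.
Proof.
move=> ps; have [pD _] := ps; have := pD x (- x).
by rewrite subrr sublinear0 // -lerBlDr sub0r.
Qed.

Lemma sublinear_subhomogeneous q :
  (forall x y, q (x + y) <= q x + q y) -> q 0 = 0 ->
  (forall (a : R) x, 0 < a -> q (a *: x) <= a * q x) -> sublinear q.
Proof.
move=> qD q0 qZ; split=> // a x; rewrite le_eqVlt => /predU1P[<-|a0].
  by rewrite scale0r q0 mul0r.
apply/eqP; rewrite eq_le qZ //= -ler_pdivlMl //.
have := qZ a^-1 (a *: x); rewrite scalerA mulVf ?gt_eqF // scale1r.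
by apply; rewrite invr_gt0.
Qed.

(** The infimum of p (z + a c) - a d over a >= 0 and c in D is the largest
    sublinear function below p that is at most - d on - D.  The case of a
    singleton D gives the linearity of minimal sublinear functions, and the
    case where p is a norm gives the separation of a point from a convex
    set. *)
Lemma sublinear_separation p D (d : R) :
  sublinear p -> D !=set0 -> convex_set D -> (forall c, D c -> d <= p c) ->
  exists q, [/\ sublinear q, forall x, q x <= p x &
                forall c, D c -> q (- c) <= - d].
Proof.
move=> ps [c0 Dc0] /convex_setP convD dD; have [pD pZ] := ps.
pose S z := [set e | exists (a : R) c, [/\ 0 <= a, D c & e = p (z + a *: c) - a * d]].
have S0 z : S z !=set0 by exists (p (z + 0 *: c0) - 0 * d), 0, c0; split.
have Slb z : lbound (S z) (- p (- z)).
  move=> _ [a [c [a0 Dc ->]]].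
  have : a * d <= p (a *: c) by rewrite pZ // ler_wpM2l // dD.
  have := pD (z + a *: c) (- z); rewrite addrAC subrr add0r; lra.
pose q z := inf (S z).
have q_le z a c : 0 <= a -> D c -> q z <= p (z + a *: c) - a * d.
  move=> a0 Dc; apply: ge_inf; first by exists (- p (- z)); apply: Slb.
  by exists a, c.
have le_q z r : (forall a c, 0 <= a -> D c -> r <= p (z + a *: c) - a * d) ->
    r <= q z.
  by move=> H; apply: lb_le_inf => // _ [a [c [a0 Dc ->]]]; apply: H.
have qp z : q z <= p z.
  by have := q_le z 0 c0 (lexx 0) Dc0; rewrite scale0r addr0 mul0r subr0.
exists q; split=> //; last first.
  move=> c Dc; have := q_le (- c) 1 c ler01 Dc.
  by rewrite scale1r addNr sublinear0 // mul1r sub0r.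
apply: sublinear_subhomogeneous.
- move=> x y; rewrite -lerBlDr; apply: (le_q) => a c a0 Dc.
  rewrite lerBlDr [leRHS]addrC -lerBlDr; apply: (le_q) => b c' b0 Dc'.
  rewrite lerBlDr.
  have pab := pD (x + a *: c) (y + b *: c').
  have [ab|ab] := eqVneq (a + b) 0.
    have [a_0 b_0] : a = 0 /\ b = 0 by lra.
    move: pab; rewrite a_0 b_0 !scale0r !addr0 !mul0r !subr0 [leRHS]addrC.
    exact: le_trans.
  have ab0 : 0 < a + b by rewrite lt_neqAle eq_sym ab addr_ge0.
  have Dm : D ((a / (a + b)) *: c + (1 - a / (a + b)) *: c').
    apply: convD => //; rewrite divr_ge0 ?(ltW ab0) //= ler_pdivrMr // mul1r.
    by rewrite lerDl.
  apply: le_trans (q_le (x + y) (a + b) _ (ltW ab0) Dm) _.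
  rewrite scalerDr !scalerA mulrBr mulr1 mulrCA divff // mulr1 [a + b]addrC addrK.
  rewrite [X in p X](_ : _ = x + a *: c + (y + b *: c')); last by rewrite addrACA.
  by move: pab; lra.
- apply/eqP; rewrite eq_le -[X in _ <= X](sublinear0 ps) qp /=.
  apply: (le_q) => a c a0 Dc.
  rewrite add0r pZ // subr_ge0.
  by rewrite ler_wpM2l ?dD.
- move=> a x a0; rewrite -ler_pdivrMl //; apply: (le_q) => b c b0 Dc.
  rewrite ler_pdivrMl //; apply: le_trans (q_le _ (a * b) c _ Dc) _.
    by rewrite mulr_ge0 // ltW.
  by rewrite -scalerA -scalerDr pZ ?(ltW a0) // mulrBr mulrA.
Qed.

(** Zorn: the pointwise infimum of a chain of sublinear functions below p is
    sublinear, and it is finite because such functions are at least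
    - p (- x) at x. *)
Lemma minimal_sublinear p : sublinear p ->
  exists q, [/\ sublinear q, forall x, q x <= p x &
    forall q', sublinear q' -> (forall x, q' x <= q x) -> forall x, q x <= q' x].
Proof.
move=> ps.
pose Q := {q : E -> R | sublinear q /\ forall x, q x <= p x}.
pose ge (q q' : Q) := `[< forall x, sval q' x <= sval q x >].
have ge_refl (u : Q) : ge u u by apply/asboolP.
have ge_trans (q1 q2 q3 : Q) : ge q1 q2 -> ge q2 q3 -> ge q1 q3.
  by move=> /asboolP H1 /asboolP H2; apply/asboolP => x; apply: le_trans (H1 x).
have Qlb (s : Q) x : - p (- x) <= sval s x.
  case: s => q [qs qp] /=; apply: le_trans (sublinearN x qs).
  by rewrite lerN2 qp.
have chain (A : set Q) : total_on A ge -> exists t, forall s, A s -> ge s t.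
  move=> totA; have [A0|/set0P[s0 As0]] := eqVneq A set0.
    have Qp : sublinear p /\ forall x, p x <= p x by split.
    by exists (exist _ p Qp) => s; rewrite A0.
  pose S x := [set sval s x | s in A].
  have S0 x : S x !=set0 by exists (sval s0 x), s0.
  pose g x := inf (S x).
  have g_le s x : A s -> g x <= sval s x.
    move=> As; apply: ge_inf; last by exists s.
    by exists (- p (- x)) => _ [t _ <-]; apply: Qlb.
  have le_g x r : (forall s, A s -> r <= sval s x) -> r <= g x.
    by move=> H; apply: lb_le_inf => // _ [s As <-]; apply: H.
  have gs : sublinear g.
    apply: sublinear_subhomogeneous.
    - move=> x y; rewrite -lerBlDr; apply: (le_g) => s As.
      rewrite lerBlDr [leRHS]addrC -lerBlDr; apply: (le_g) => t At.
      have [u [Au us ut]] : exists u, [/\ A u, forall x, sval u x <= sval s x &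
          forall x, sval u x <= sval t x].
        by have [/asboolP st|/asboolP ts] := totA s t As At; [exists t|exists s].
      rewrite lerBlDr; apply: le_trans (g_le u _ Au) _.
      have [[uD _] _] := svalP u; apply: le_trans (uD x y) _.
      by rewrite [leRHS]addrC lerD.
    - apply/eqP; rewrite eq_le; apply/andP; split.
        by have [us _] := svalP s0; rewrite -(sublinear0 us) g_le.
      by apply: (le_g) => s As; have [us _] := svalP s; rewrite (sublinear0 us).
    - move=> a x a0; rewrite -ler_pdivrMl //; apply: (le_g) => s As.
      have [[_ sZ] _] := svalP s.
      by rewrite ler_pdivrMl // -sZ ?(ltW a0) // g_le.
  have gp x : g x <= p x.
    by have [_ sp] := svalP s0; apply: le_trans (sp x); apply: g_le.
  by exists (exist _ g (conj gs gp)) => s As; apply/asboolP => x /=; apply: g_le.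
have [[q [qs qp]] qmin] := ZL_preorder
  (exist _ p (conj ps (fun x => lexx (p x))) : Q) ge_refl ge_trans chain.
exists q; split=> // q' q's q'q.
have q'p x : q' x <= p x by apply: le_trans (qp x).
by apply/asboolP/(qmin (exist _ q' (conj q's q'p)))/asboolP.
Qed.

(** A minimal sublinear q is linear: minimality applied to the function that
    sublinear_separation provides for the singleton of x and d = q x gives
    q (- x) <= - q x. *)
Theorem hahn_banach p : sublinear p ->
  exists2 f : E -> R^o, linear f & forall x, f x <= p x.
Proof.
move=> /minimal_sublinear[q [qs qp qmin]].
have [qD qZ] := qs.
have qA x y : q (x + y) = q x + q y.
  apply/eqP; rewrite eq_le qD /=.
  have [||c|q' [q's q'q q'N]] := @sublinear_separation q [set x] (q x) qs.
  - by exists x.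
  - apply/convex_setP => _ _ a -> -> _; rewrite -scalerDl subrKC scale1r.
    by [].
  - by move=> ->.
  have qN : q (- x) <= - q x by apply: le_trans (qmin _ q's q'q _) _; apply: q'N.
  by have := qD (x + y) (- x); rewrite addrAC subrr add0r; lra.
have qN x : q (- x) = - q x.
  by have := qA x (- x); rewrite subrr sublinear0 //; lra.
exists q => // a x y; rewrite qA; congr (_ + _).
have [a0|a0] := leP 0 a; first by rewrite qZ.
by rewrite -[a]opprK scaleNr qN qZ ?oppr_ge0 ?(ltW a0) // scaleNr.
Qed.

End HahnBanach.

(** * Reflexive spaces and compact operators *)

Lemma sublinear_norm (R : realType) (E : normedModType R) :
  sublinear (fun x : E => `|x|).
Proof.
by split=> [x y|a x a0]; [exact: ler_normD | rewrite normrZ ger0_norm].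
Qed.

(** The point is moved to the origin; then the norm is at least the distance e
    on C - x, and a linear function below the function of sublinear_separation
    is at most - e on x - C, and bounded by the norm, hence continuous. *)
Lemma convex_separation (R : realType) (E : completeNormedModType R)
    (C : set E) (x : E) :
  closed C -> convex_set C -> ~ C x ->
  exists2 f : E -> R^o, dual_space f &
    exists2 e : R, 0 < e & forall c, C c -> f x + e <= f c.
Proof.
move=> clC /convex_setP cvC nCx.
have [e /= e0 eC] : exists2 e : R, 0 < e & forall c, C c -> e <= `|c - x|.
  have : nbhs x (~` C) by apply: open_nbhs_nbhs; split=> //; exact: closed_openC.
  move=> /nbhs_ballP[e /= e0 eC]; exists e => // c Cc.
  rewrite leNgt; apply/negP => ce; apply: (eC c) => //.
  by rewrite -ball_normE /= distrC.
have [[c0 Cc0]|C0] := pselect (C !=set0); last first.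
  exists (fun=> 0); last by exists 1 => // c Cc; case: C0; exists c.
  split; last by move=> y; exact: cvg_cst.
  by move=> a y z; rewrite scaler0 addr0.
pose D := [set c - x | c in C].
have [| |_ [c Cc <-]|q [qs qn qD]] := @sublinear_separation _ _ _ D e (sublinear_norm E).
- by exists (c0 - x), c0.
- apply/convex_setP => _ _ a [y Cy <-] [z Cz <-] a01.
  exists (a *: y + (1 - a) *: z); first exact: cvC.
  by rewrite !scalerBr addrACA -opprD -scalerDl subrKC scale1r.
- exact: eC.
have [f fl fq] := hahn_banach qs.
have fn y : f y <= `|y| by apply: le_trans (fq y) (qn y).
pose L : {linear E -> R^o} := HB.pack f (GRing.isLinear.Build R E R^o *:%R f fl).
have fB y z : f (y - z) = f y - f z by exact: (linearB L).
have fN y : f (- y) = - f y by exact: (linearN L).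
exists f; last first.
  exists e => // c Cc; have : f (- (c - x)) <= - e.
    by apply: le_trans (fq _) (qD _ _); exists c.
  by rewrite fN fB; lra.
split=> // y; apply/cvgrPdist_lt => r r0; near=> z.
apply: (@le_lt_trans _ _ `|y - z|).
  rewrite -fB ler_norml fn andbT; have := fn (- (y - z)).
  by rewrite fN normrN; lra.
by near: z; apply: cvgr_dist_lt.
Unshelve. all: by end_near. Qed.

Lemma dual_norm_ubound (R : realType) (E : completeNormedModType R)
    (f : E -> R^o) (x : E) : dual_space f -> `|x| <= 1 -> `|f x| <= dual_norm f.
Proof.
move=> [fl fc] x1.
pose L : {linear E -> R^o} := HB.pack f (GRing.isLinear.Build R E R^o *:%R f fl).
have /linear_boundedP/pinfty_ex_gt0[M M0 fM] : bounded_near L (nbhs (0 : E)).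
  by apply/linear_bounded_continuous.
apply: sup_ubound; last by exists x.
exists M => _ [y y1 <-]; apply: le_trans (fM y) _.
by rewrite ler_piMr // ltW.
Qed.

Lemma le_dual_norm (R : realType) (E : completeNormedModType R)
    (f : E -> R^o) (x : E) : dual_space f -> `|f x| <= dual_norm f * `|x|.
Proof.
move=> fd; have [fl _] := fd.
pose L : {linear E -> R^o} := HB.pack f (GRing.isLinear.Build R E R^o *:%R f fl).
have f0 : f 0 = 0 by exact: (linear0 L).
have [->|x0] := eqVneq x 0; first by rewrite f0 !normr0 mulr0.
have nx0 : 0 < `|x| by rewrite normr_gt0.
rewrite -ler_pdivrMr //.
have fZ : f (`|x|^-1 *: x) = `|x|^-1 * f x.
  by have := fl `|x|^-1 x 0; rewrite addr0 f0 addr0.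
have := @dual_norm_ubound _ _ f (`|x|^-1 *: x) fd.
by rewrite normfZV // fZ normrM normfV normr_id mulrC; apply.
Qed.

Lemma ultra_cvg_compact (S : Type) (X : topologicalType) (G : set_system S)
    (f : S -> X) (K : set X) :
  UltraFilter G -> compact K -> G (f @^-1` K) ->
  exists l : X, f @ G --> l.
Proof.
move=> GU cK GK; have [l [_ lG]] := cK (f @ G) _ GK; exists l => A Al.
have [//|GA] := in_ultra_setVsetC (f @^-1` A) GU.
by have [y [/= nA Ay]] := lG (~` A) A GA Al.
Qed.

Lemma bounded_setP (R : realType) (E : normedModType R) (B : set E) :
  bounded_set B <-> exists M, forall x, B x -> `|x| <= M.
Proof.
split=> [/pinfty_ex_gt0[M _ BM]|[M BM]]; first by exists M.
exists M; split; first exact: num_real.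
by move=> M' MM' x Bx; apply: le_trans (BM x Bx) (ltW MM').
Qed.

(** The form of weak compactness used here.  Along an ultrafilter finer than F
    every continuous functional is bounded and so has a limit; this limit is
    linear and bounded in the functional, so by reflexivity it is the
    evaluation at a point x.  A closed convex C in F that does not contain x
    would be separated from x by a functional, which contradicts the
    definition of x as a limit. *)
Theorem reflexive_filter (R : realType) (X : completeNormedModType R)
    (F : set_system X) (B : set X) :
  reflexive_space X -> ProperFilter F -> bounded_set B -> F B ->
  exists x, forall C, closed C -> convex_set C -> F C -> C x.
Proof.
move=> reflX FF /bounded_setP[M BM] FB.
have [G [GU FG]] := ultraFilterLemma FF.
have fB (f : X -> R^o) : dual_space f -> forall u, B u -> `|f u| <= M * dual_norm f.
  move=> fd u Bu; apply: le_trans (le_dual_norm u fd) _.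
  rewrite mulrC ler_wpM2r ?BM //.
  apply: le_trans (dual_norm_ubound (x := 0) fd _); first exact: normr_ge0.
  by rewrite normr0.
have f_cvg (f : X -> R^o) : dual_space f -> f @ G --> (lim (f @ G) : R^o).
  move=> fd.
  suff [l fl] : exists l : R^o, f @ G --> l by apply: cvgP fl.
  apply: (@ultra_cvg_compact _ _ _ _
      `[- (M * dual_norm f), M * dual_norm f]%classic).
    exact: segment_compact.
  by apply: FG; apply: filterS FB => u Bu /=; rewrite in_itv /= -ler_norml fB.
have [|x xP] := reflX (fun f => lim (f @ G)); first split.
- move=> a f g fd gd; apply: cvg_lim => //.
  apply: cvgD; last exact: f_cvg.
  by apply: cvgZl_tmp; exact: f_cvg.
- exists M => f fd.
  apply: (@closed_cvg _ R G _ (fun u => `|f u|) [set r : R | r <= M * dual_norm f]).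
  - exact: closed_le.
  - by apply: FG; apply: filterS FB; apply: fB.
  - by apply: cvg_norm; apply: f_cvg.
exists x => C clC cvC FC; apply: contrapT => nCx.
have [f fd [e e0 fe]] := convex_separation clC cvC nCx.
have : f x + e <= lim (f @ G).
  apply: (@closed_cvg _ R G _ f [set r : R | f x + e <= r]).
  - exact: closed_ge.
  - by apply: FG; apply: filterS FC; apply: fe.
  - exact: f_cvg.
by rewrite xP //; lra.
Qed.

Lemma compact_operator_continuous (R : realType) (X Y : completeNormedModType R)
    (T : {linear X -> Y}) : compact_operator T -> continuous T.
Proof.
move=> cT; apply/linear_bounded_continuous.
have /cT[K TK [cK _]] : bounded_set [set x : X | `|x| <= 1].
  by apply/bounded_setP; exists 1.
have /bounded_setP[M KM] := compact_bounded cK.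
apply/ex_bound; exists M; apply/nbhs_ballP; exists 1 => //= x.
rewrite -ball_normE /= sub0r normrN => x1; apply/KM/TK.
by exists x => //=; apply: ltW.
Qed.

(** Only closedness needs an argument, and it is where reflexivity enters: if y
    is in the closure of T @` K, the sets of the u in K with T u within e of y
    are nonempty, closed, convex and decreasing with e, so they have a common
    point, which T maps to y.  This moves the whole problem to compact sets for
    the norm, and no weak topology is needed. *)
Theorem compact_operator_image (R : realType) (X Y : completeNormedModType R)
    (T : {linear X -> Y}) (K : set X) :
  reflexive_space X -> compact_operator T -> closed K -> convex_set K ->
  bounded_set K -> compact (T @` K).
Proof.
move=> reflX cT clK cvK bK; have Tc := compact_operator_continuous cT.
suff clTK : closed (T @` K) by rewrite -precompact_closed //; apply: cT.
move=> y yTK.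
pose S (e : R) := K `&` [set u | `|y - T u| <= e].
have S0 e : 0 < e -> S e !=set0.
  move=> e0; have [_ [[u Ku <-]]] := yTK _ (nbhsx_ballx y e e0).
  by rewrite -ball_normE /= => /ltW; exists u.
have Scl e : closed (S e).
  apply: closedI => //.
  apply: (preimage_closed (f := fun u => `|y - T u|) _ (@closed_le _ e)) => u _.
  by apply: cvg_norm; apply: cvgB; [exact: cvg_cst|exact: Tc].
have Scv e : convex_set (S e).
  apply/convex_setP => u v a [Ku ue] [Kv ve] a01.
  split; first by move/convex_setP : cvK; apply.
  have /andP[a0 a1] := a01; rewrite /= linearP linearZ /=.
  have -> : y - (a *: T u + (1 - a) *: T v) =
      a *: (y - T u) + (1 - a) *: (y - T v).
    by rewrite !scalerBr addrACA -opprD -scalerDl subrKC scale1r.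
  apply: le_trans (ler_normD _ _) _; rewrite !normrZ.
  rewrite (ger0_norm a0) ger0_norm ?subr_ge0 //.
  have -> : e = a * e + (1 - a) * e by ring.
  by rewrite lerD // ler_wpM2l // subr_ge0.
pose F := filter_from [set e : R | 0 < e] S.
have FF : ProperFilter F.
  apply: filter_from_proper => //; apply: filter_from_filter.
    by exists 1 => /=.
  move=> e e' /= e0 e'0; exists (Num.min e e'); first by rewrite /= lt_min e0.
  by move=> u [Ku]; rewrite /= le_min => /andP[ue ue']; split; split.
have FS e : 0 < e -> F (S e) by move=> e0; exists e.
have FK : F K by exists 1 => //=; move=> u [].
have [x xP] := reflexive_filter reflX FF bK FK.
exists x; first by have [] := xP _ (Scl 1) (Scv 1) (FS 1 ltr01).
apply/esym/eqP; rewrite -subr_eq0 -normr_le0; apply/ler_addgt0Pl => e e0.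
by rewrite addr0; have [] := xP _ (Scl e) (Scv e) (FS e e0).
Qed.

(** * The generalized directional derivative *)

Section LimfEsup.
Variables (R : realType) (X : choiceType) (S : filteredType X) (F : set_system S).
Context {FF : ProperFilter F}.
Implicit Types (f : S -> \bar R) (a : \bar R).

Lemma limf_esup_lt f a : (limf_esup f F < a)%E -> \forall p \near F, (f p < a)%E.
Proof.
move=> /ereal_inf_lt[_ [V FV <-] Va].
apply: filterS FV => p Vp; apply: le_lt_trans Va.
by apply: ereal_sup_ubound; exists p.
Qed.

Lemma limf_esup_le f a : (\forall p \near F, (f p <= a)%E) -> (limf_esup f F <= a)%E.
Proof.
move=> fa; apply: (@le_trans _ _ (ereal_sup (f @` [set p | (f p <= a)%E]))).
  by apply: ereal_inf_lbound; exists [set p | (f p <= a)%E].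
by apply: ge_ereal_sup => _ [p fp <-].
Qed.

Lemma limf_esup_ge f a : (\forall p \near F, (a <= f p)%E) -> (a <= limf_esup f F)%E.
Proof.
move=> fa; apply: le_ereal_inf_tmp => _ [V FV <-].
have [p [Vp fp]] := filter_ex (filterI FV fa).
by apply: le_trans fp _; apply: ereal_sup_ubound; exists p.
Qed.
End LimfEsup.

Section Clarke.
Variables (R : realType) (E : completeNormedModType R) (g : E -> R) (x : E).

Definition clarke_quotient (h : E) (p : E * R) : R :=
  (g (p.1 + p.2 *: h) - g p.1) / p.2.

Definition clarke_base : set_system (E * R) := filter_prod (nbhs x) (0 : R)^'+.

(** The derivative partial_clarke is the case where g freezes all the variables
    but one. *)
Definition clarke (h : E) : \bar R :=
  limf_esup (fun p => (clarke_quotient h p)%:E) clarke_base.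

Instance clarke_base_filter : ProperFilter clarke_base.
Proof. exact: filter_prod_proper. Qed.

Lemma clarke_base_pos : \forall p \near clarke_base, 0 < p.2.
Proof.
exists (setT, [set t | 0 < t]); last by move=> p [].
by split; [exact: filterT | exact: nbhs_right_gt].
Qed.

Lemma clarke_base_shift h : p.1 + p.2 *: h @[p --> clarke_base] --> x.
Proof.
rewrite -[X in _ --> X](addr0 x) -(scale0r h).
apply: cvgD; first exact: cvg_fst.
apply: cvgZr_tmp; apply: cvg_trans (@cvg_snd _ _ _ _ _) _.
exact: cvg_within.
Qed.

Lemma clarke_near_shift h (P : set (E * R)) : clarke_base P ->
  \forall p \near clarke_base, P (p.1 + p.2 *: h, p.2).
Proof.
move=> [[U V] /= [Ux V0] UVP].
have HU : clarke_base [set p | U (p.1 + p.2 *: h)] by exact: clarke_base_shift.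
have HV : clarke_base [set p | V p.2] by exact: cvg_snd V0.
by apply: filterS2 HU HV => p Up Vp; apply: UVP.
Qed.

Lemma clarke_near_scale (a : R) (P : set (E * R)) : 0 < a -> clarke_base P ->
  \forall p \near clarke_base, P (p.1, a * p.2).
Proof.
move=> a0 [[U V] /= [Ux V0] UVP].
exists (U, [set t | V (a * t)]); last by move=> p [Up Vp]; apply: UVP.
split=> //=; move: V0 => [e /= e0 eV].
exists (e / a); first by rewrite /= divr_gt0.
move=> t /= ta t0; apply: eV; last by rewrite mulr_gt0.
move: ta; rewrite /= !sub0r !normrN normrM (gtr0_norm a0) => ta.
by rewrite mulrC -ltr_pdivlMr.
Qed.

Hypothesis g_lip : locally_lipschitz g.

(** A local Lipschitz constant bounds the quotients, since p.1 and
    p.1 + p.2 *: h are both close to x. *)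
Lemma clarke_quotient_bounded :
  exists L : R, forall h, \forall p \near clarke_base,
    `|clarke_quotient h p| <= L * `|h|.
Proof.
have [U Ux /pinfty_ex_gt0[L L0 gL]] := g_lip x.
exists L => h; near=> p.
have p0 : 0 < p.2 by near: p; exact: clarke_base_pos.
have U1 : U p.1 by near: p; apply: (@cvg_fst _ _ (nbhs x) (0 : R)^'+).
have U2 : U (p.1 + p.2 *: h) by near: p; apply: (@clarke_base_shift h).
rewrite /clarke_quotient normrM normfV (gtr0_norm p0) ler_pdivrMr //.
have := gL (p.1 + p.2 *: h, p.1) (conj U2 U1).
by rewrite /= addrAC subrr add0r normrZ (gtr0_norm p0) -mulrA [p.2 * _]mulrC.
Unshelve. all: by end_near. Qed.

Lemma clarke_fin_num h : clarke h \is a fin_num.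
Proof.
have [L /(_ h) qL] := clarke_quotient_bounded.
rewrite fin_numElt; apply/andP; split.
  apply: (@lt_le_trans _ _ (- (L * `|h|))%:E); first exact: ltNyr.
  apply: limf_esup_ge; apply: filterS qL => p.
  by rewrite lee_fin ler_norml => /andP[].
apply: (@le_lt_trans _ _ (L * `|h|)%:E); last exact: ltry.
apply: limf_esup_le; apply: filterS qL => p.
by rewrite lee_fin ler_norml => /andP[].
Qed.

(** The quotient for h + h' at (w, t) is the sum of the quotient for h' at
    (w, t) and of the quotient for h at (w + t *: h', t), and the quotient for
    a *: h at (w, t) is a times the one for h at (w, a * t); both changes of
    base point preserve the filter of the upper limit. *)
Theorem clarke_sublinear : sublinear (fun h => fine (clarke h)).
Proof.
pose k h := fine (clarke h).
have kE h : clarke h = (k h)%:E by rewrite /k fineK ?clarke_fin_num.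
have k_lt h r : k h < r -> \forall p \near clarke_base, clarke_quotient h p < r.
  by rewrite -lte_fin -kE => /limf_esup_lt; apply: filterS => p; rewrite lte_fin.
have k_le h r : (\forall p \near clarke_base, clarke_quotient h p <= r) -> k h <= r.
  rewrite -lee_fin -kE => H; apply: limf_esup_le.
  by apply: filterS H => p; rewrite lee_fin.
change (sublinear k); apply: sublinear_subhomogeneous.
- move=> h h'; apply/ler_addgt0Pl => e e0; apply: k_le; near=> p.
  have p0 : 0 < p.2 by near: p; exact: clarke_base_pos.
  have -> : clarke_quotient (h + h') p =
      clarke_quotient h (p.1 + p.2 *: h', p.2) + clarke_quotient h' p.
    rewrite /clarke_quotient /= -mulrDl; congr (_ / _).
    by rewrite scalerDr [p.2 *: h + _]addrC addrA; ring.
  apply: (@le_trans _ _ ((k h + e / 2) + (k h' + e / 2))); last by lra.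
  apply/ltW/ltrD; near: p.
    apply: (@clarke_near_shift h' [set p | clarke_quotient h p < k h + e / 2]).
    by apply: k_lt; rewrite ltrDl divr_gt0.
  by apply: k_lt; rewrite ltrDl divr_gt0.
- have c0 p : clarke_quotient 0 p = 0 by rewrite /clarke_quotient scaler0 addr0 subrr mul0r.
  apply: EFin_inj; rewrite -kE; apply/eqP; rewrite eq_le; apply/andP; split.
    by apply: limf_esup_le; apply: nearW => p; rewrite c0.
  by apply: limf_esup_ge; apply: nearW => p; rewrite c0.
- move=> a h a0; rewrite -ler_pdivrMl //; apply/ler_addgt0Pl => e e0.
  rewrite ler_pdivrMl //; apply: k_le; near=> p.
  have p0 : 0 < p.2 by near: p; exact: clarke_base_pos.
  have -> : clarke_quotient (a *: h) p = a * clarke_quotient h (p.1, a * p.2).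
    rewrite /clarke_quotient /= scalerA [p.2 * a]mulrC; field.
    by rewrite !gt_eqF.
  rewrite ler_pM2l //; apply/ltW; near: p.
  apply: (@clarke_near_scale a [set p | clarke_quotient h p < e + k h]) => //.
  by apply: k_lt; rewrite ltrDr.
Unshelve. all: by end_near. Qed.

End Clarke.

(** * Nash generalized derivative points *)

Section Nash.
Variables (R : realType) (n : nat) (Y X : 'I_n -> completeNormedModType R).
Variables (T : forall i, {linear X i -> Y i}) (A : 'I_n -> prod_topology Y -> R).
Hypothesis lipschitzA : forall i, locally_lipschitz_in i (A i).

Lemma partial_clarke_fin_num i y h : partial_clarke i (A i) y h \is a fin_num.
Proof. exact: (clarke_fin_num (y i) (lipschitzA (i := i) y) h). Qed.

Lemma partial_clarke_sublinear i y :
  sublinear (fun h => fine (partial_clarke i (A i) y h)).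
Proof. exact: (clarke_sublinear (y i) (lipschitzA (i := i) y)). Qed.

(** The inequalities only involve the images T i u, so they are solved by ky_fan
    on the sets T i @` K i, which are compact and convex. *)
Theorem nash_bounded (K : forall i, set (X i)) :
  (forall i, reflexive_space (X i)) -> (forall i, compact_operator (T i)) ->
  (forall i, upper_semicontinuous
    (fun p : prod_topology Y * Y i => partial_clarke i (A i) p.1 p.2)) ->
  (forall i, K i !=set0) -> (forall i, closed (K i)) ->
  (forall i, convex_set (K i)) -> (forall i, bounded_set (K i)) ->
  exists u0 : forall i, X i,
    (forall i, K i (u0 i)) /\ nash_derivative_point T A K u0.
Proof.
move=> reflX compactT uscA K0 clK cvK bK.
have [|i|i|i y|i z y a|y0 Cy0 y0P] := @ky_fan R n Y (fun i => T i @` K i)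
  (fun i y h => fine (partial_clarke i (A i) y h)).
- by move=> i; apply: compact_operator_image.
- apply/convex_setP => _ _ a [u Ku <-] [v Kv <-] a01.
  exists (a *: u + (1 - a) *: v); last by rewrite linearP linearZ.
  by move/convex_setP: (cvK i); apply.
- by have [u Ku] := K0 i; exists (T i u), u.
- exact: partial_clarke_sublinear.
- rewrite -lte_fin fineK ?partial_clarke_fin_num //.
  move=> /(uscA i (y, z - y i))[V [[P Q] /= [Py Qy] PQV] VA].
  have Py' : nbhs y [set y' : prod_topology Y | Q (z - y' i)].
    have : (fun y' : prod_topology Y => z - y' i) @ y --> z - y i.
      apply: (@cvgB _ _ _ (nbhs y) _ (cst z) (proj i) z (y i)).
        exact: cvg_cst.
      exact: (@proj_continuous _ Y i y).
    exact.
  apply: filterS2 Py Py' => y' Py' Qy' /=.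
  rewrite -lte_fin fineK ?partial_clarke_fin_num //.
  exact: (VA (y', z - y' i) (PQV (_, _) (conj Py' Qy'))).
have uE i : exists u, K i u /\ T i u = y0 i.
  by have [v Kv <-] := Cy0 i; exists v.
pose u i := sval (cid (uE i)); have uP i := svalP (cid (uE i)).
exists u; split=> [i|i v Kv]; first by have [] := uP i.
have -> : map_components T u = y0.
  by apply: functional_extensionality_dep => j; have [] := uP j.
have [_ ->] := uP i.
rewrite -[leRHS]fineK ?partial_clarke_fin_num // lee_fin.
by apply: y0P; exists (v i).
Qed.

(** Intersect K with a ball of radius r exceeding by at least 1 the norms of the
    points of K0, and take a solution u there.  Testing it against v0 makes the
    sum in the coercivity condition nonnegative, so u lies in K0, that is, well
    inside the ball.  Then for v in K a small step from u towards v stays in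
    the ball, and positive homogeneity turns the inequality for the step into
    the inequality for v. *)
Theorem nash_coercive (K K0 : forall i, set (X i)) (v0 : forall i, X i) :
  (forall i, reflexive_space (X i)) -> (forall i, compact_operator (T i)) ->
  (forall i, upper_semicontinuous
    (fun p : prod_topology Y * Y i => partial_clarke i (A i) p.1 p.2)) ->
  (forall i, closed (K i)) -> (forall i, convex_set (K i)) ->
  (forall i, K0 i `<=` K i) -> (forall i, bounded_set (K0 i)) ->
  (forall i, K0 i (v0 i)) ->
  (forall u : forall i, X i,
     (forall i, K i (u i)) -> ~ (forall i, K0 i (u i)) ->
     (\sum_(i < n) partial_clarke i (A i) (map_components T u)
        (T i (v0 i) - T i (u i))%R < 0)%E) ->
  exists u0 : forall i, X i,
    (forall i, K i (u0 i)) /\ nash_derivative_point T A K u0.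
Proof.
move=> reflX compactT uscA clK cvK K0K bK0 K0v coercive.
have ME i : exists M, forall x, K0 i x -> `|x| <= M by apply/bounded_setP; exact: bK0.
pose M i := sval (cid (ME i)); have MP i := svalP (cid (ME i)).
pose r := \sum_i `|M i| + 1.
have K0r i x : K0 i x -> `|x| + 1 <= r.
  move=> /(MP i) xM; rewrite lerD2r; apply: le_trans xM _.
  rewrite (bigD1 i) //=; apply: le_trans (ler_norm _) _.
  by rewrite lerDl sumr_ge0.
pose Kr i := K i `&` [set x | `|x| <= r].
have Krv i : Kr i (v0 i).
  split; first exact: K0K.
  by apply: le_trans (K0r i _ (K0v i)); rewrite lerDl.
have [||||u [Kru uP]] := @nash_bounded Kr reflX compactT uscA.
- by move=> i; exists (v0 i).
- move=> i; apply: closedI => //.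
  apply: (preimage_closed _ (@closed_le _ r)) => x _; exact: norm_continuous.
- move=> i; apply/convex_setP => x y a [Kx xr] [Ky yr] a01.
  split; first by move/convex_setP: (cvK i); apply.
  have /andP[a0 a1] := a01; apply: le_trans (ler_normD _ _) _.
  rewrite !normrZ (ger0_norm a0) ger0_norm ?subr_ge0 //.
  have -> : r = a * r + (1 - a) * r by ring.
  by rewrite lerD // ler_wpM2l // subr_ge0.
- by move=> i; apply/bounded_setP; exists r => x [].
have Ku i : K i (u i) by have [] := Kru i.
have K0u : forall i, K0 i (u i).
  apply: contrapT => nK0u; have := coercive u Ku nK0u.
  by apply/negP; rewrite -leNgt; apply: sume_ge0 => i _; apply: uP.
exists u; split=> // i v Kv.
set h := T i (v i) - T i (u i).

(* A step size in (0, 1] for which the step has norm at most 1. *)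
pose t := (1 + `|v i - u i|)^-1.
have t0 : 0 < t by rewrite invr_gt0 ltr_pwDl.
have t1 : t <= 1 by rewrite invf_le1 ?lerDl // ltr_pwDl.
have tv : t * `|v i - u i| <= 1.
  by rewrite /t mulrC ler_pdivrMr ?mul1r ?lerDr // ltr_pwDl.
pose w := dfwith u i (u i + t *: (v i - u i)).
have Krw j : Kr j (w j).
  rewrite /w; have [->|ji] := eqVneq j i; last by rewrite dfwithout // eq_sym.
  rewrite dfwithin; split.
    have -> : u i + t *: (v i - u i) = t *: v i + (1 - t) *: u i.
      by rewrite scalerBr scalerBl scale1r addrCA addrA.
    by move/convex_setP: (cvK i); apply => //; rewrite (ltW t0).
  apply: le_trans (ler_normD _ _) _; apply: le_trans (K0r i _ (K0u i)).
  by rewrite lerD2l normrZ (gtr0_norm t0).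
have := uP i w Krw; rewrite /w dfwithin.
rewrite linearD linearZ /= linearB addrAC subrr add0r -/h.
rewrite -[X in (_ <= X)%E]fineK ?partial_clarke_fin_num // lee_fin.
have [_ ->] := partial_clarke_sublinear i (map_components T u); last exact: ltW.
rewrite pmulr_rge0 // -lee_fin fineK //.
exact: partial_clarke_fin_num.
Qed.

End Nash.

Theorem theorem4p1 (R : realType) (n : nat)
  (Y X : 'I_n -> completeNormedModType R)
  (reflexiveY : forall i, reflexive_space (Y i))
  (reflexiveX : forall i, reflexive_space (X i))
  (T : forall i, {linear X i -> Y i})
  (compactT : forall i, compact_operator (T i))
  (A : 'I_n -> prod_topology Y -> R)
  (continuousA : forall i, continuous (A i))
  (lipschitzA : forall i, locally_lipschitz_in i (A i))
  (uscA : forall i, upper_semicontinuous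
    (fun p : prod_topology Y * Y i => partial_clarke i (A i) p.1 p.2)) :
  (forall K : forall i, set (X i),
     (forall i, K i !=set0) ->
     (forall i, closed (K i)) ->
     (forall i, convex_set (K i)) ->
     (forall i, bounded_set (K i)) ->
     exists u0 : forall i, X i,
       (forall i, K i (u0 i)) /\ nash_derivative_point T A K u0)
  /\
  (forall K : forall i, set (X i),
     (forall i, K i !=set0) ->
     (forall i, closed (K i)) ->
     (forall i, convex_set (K i)) ->
     forall (K0 : forall i, set (X i)) (v0 : forall i, X i),
     (forall i, K0 i `<=` K i) ->
     (forall i, bounded_set (K0 i)) ->
     (forall i, closed (K0 i)) ->
     (forall i, K0 i (v0 i)) ->
     (forall u : forall i, X i,
        (forall i, K i (u i)) -> ~ (forall i, K0 i (u i)) ->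
        (\sum_(i < n) partial_clarke i (A i) (map_components T u)
           (T i (v0 i) - T i (u i))%R < 0)%E) ->
     exists u0 : forall i, X i,
       (forall i, K i (u0 i)) /\ nash_derivative_point T A K u0).
Proof.
split=> [K K0 clK cvK bK|K _ clK cvK K0 v0 K0K bK0 _ K0v coercive].
  exact: nash_bounded.
exact: nash_coercive coercive.
Qed.
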